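(* Let $r$ be a power of $2$. For each odd integer $n>0$ let $A_n\in t\,\mathbb{Z}/2[t^2]$, and suppose that for all odd $n>0$ \[ A_{n+8r}=t^{8r}A_n+t^{2r}A_{n+2r}. \] Say that $A_n$ satisfies condition $(1\delta)$ if, writing $t^n=[a,b]$: when $a>0$, $A_n$ is a sum of monomials preceding $[a-1,b]$; when $a=0$, $A_n$ is a sum of monomials each equal to or preceding $[0,b-1]$. If $A_n$ satisfies $(1\delta)$ for every odd $n<8r^2$, then $A_n$ satisfies $(1\delta)$ for every odd $n>0$.
   Context: $\mathbb{N}=\{0,1,2,\dots\}$. Let $g:\mathbb{N}\to\mathbb{N}$ be defined by $g(0)=0$, $g(2n)=4g(n)$, $g(2n+1)=g(2n)+1$. For $a,b\in\mathbb{N}$, $[a,b]$ denotes the monomial $t^{1+2g(a)+4g(b)}\in\mathbb{Z}/2[t]$; $(a,b)\mapsto[a,b]$ is a bijection from $\mathbb{N}\times\mathbb{N}$ onto the monomials $t^k$, $k$ odd and positive. Say $[c,d]$ precedes (is earlier than) $[a,b]$ if $c+d<a+b$, or $c+d=a+b$ and $d<b$. ''A sum of monomials'' with some property means a finite sum (possibly empty, i.e. $0$) of distinct monomials with that property. When $b=0$, no monomial is ''equal to or preceding $[0,b-1]$'', so the condition then means $A_n=0$. *)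

(* Defs.v *)
From mathcomp Require Import all_boot all_order all_algebra.
From mathcomp Require Import zify.

Set Implicit Arguments.
Unset Strict Implicit.
Unset Printing Implicit Defensive.

Import GRing.Theory.
Local Open Scope ring_scope.

(* [k] only bounds the recursion depth; the defining equations of [g] are
   [g0], [g_even] and [g_odd] below. *)
Fixpoint g_rec (k n : nat) : nat :=
  if k is k'.+1 then (4 * g_rec k' n./2 + odd n)%N else 0%N.

Definition g (n : nat) : nat := g_rec n n.

Lemma g_rec0 k : g_rec k 0 = 0%N.
Proof. by elim: k => //= k ->. Qed.

Lemma g_rec_stable k1 k2 n :
  (n <= k1)%N -> (n <= k2)%N -> g_rec k1 n = g_rec k2 n.
Proof.
elim: k1 k2 n => [|k1 IH] [|k2] [|n] //=; rewrite ?g_rec0 // => h1 h2.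
by rewrite (IH k2) //; lia.
Qed.

Lemma gE n : g n = (4 * g n./2 + odd n)%N.
Proof.
case: n => [//|n]; rewrite {1}/g /=; congr (4 * _ + _)%N.
by apply: g_rec_stable; lia.
Qed.

Lemma g0 : g 0 = 0%N.
Proof. by []. Qed.

Lemma g_even n : g (2 * n) = (4 * g n)%N.
Proof. by rewrite gE mul2n doubleK odd_double addn0. Qed.

Lemma g_odd n : g (2 * n + 1) = (g (2 * n) + 1)%N.
Proof. by rewrite g_even gE (_ : (2 * n + 1)./2 = n) 1?(_ : odd (2 * n + 1)); lia. Qed.

(* The pair (a, b) stands for the monomial [a, b]. *)
Definition mono (p : nat * nat) : {poly 'F_2} :=
  'X^(1 + 2 * g p.1 + 4 * g p.2).

Lemma g_add_inj a b c d :
  (g a + 2 * g b = g c + 2 * g d)%N -> a = c /\ b = d.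
Proof.
have [m] := ubnP (a + b + c + d)%N.
elim: m a b c d => // m IH a b c d hm.
have [z _|z] := posnP (a + b + c + d); first by lia.
rewrite (gE a) (gE b) (gE c) (gE d) => h.
by have [||e1 e2] := IH a./2 b./2 c./2 d./2; lia.
Qed.

Lemma mono_inj : injective mono.
Proof.
case=> a b [c d] /(congr1 (fun q : {poly 'F_2} => size q)).
rewrite !size_polyXn /= => h.
by have [|-> ->] // := @g_add_inj a b c d; lia.
Qed.

Lemma mono_surj n : odd n -> exists p, 'X^n = mono p.
Proof.
suff H m : exists a b, m = (g a + 2 * g b)%N.
  move=> on; have [a [b e]] := H n./2; exists (a, b).
  by rewrite /mono /=; congr 'X^_; lia.
elim/ltn_ind: m => m IH.
case: (posnP m) => [->|m0]; first by exists 0%N, 0%N.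
have [|a [b e]] := IH (m %/ 4)%N; first by lia.
exists (2 * a + odd m)%N, (2 * b + odd m./2)%N.
by rewrite [g (_ + odd m)]gE [g (_ + odd m./2)]gE
  (_ : (2 * a + odd m)./2 = a) 1?(_ : (2 * b + odd m./2)./2 = b); lia.
Qed.

Definition precedes (p q : nat * nat) : bool :=
  (p.1 + p.2 < q.1 + q.2)%N || ((p.1 + p.2 == q.1 + q.2)%N && (p.2 < q.2)%N).

Definition sum_of_monomials (P : pred (nat * nat)) (f : {poly 'F_2}) : Prop :=
  exists s : seq (nat * nat),
    [/\ uniq [seq mono p | p <- s], all P s & f = \sum_(p <- s) mono p].

(* Well posed for odd n by [mono_surj] and [mono_inj]: there is exactly one
   pair (a, b) with t^n = [a, b]. *)
Definition cond1delta (A : nat -> {poly 'F_2}) (n : nat) : Prop :=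
  forall a b : nat, 'X^n = mono (a, b) ->
    ((0 < a)%N ->
       sum_of_monomials (fun p => precedes p (a.-1, b)) (A n)) /\
    (a = 0%N ->
       sum_of_monomials
         (fun p => (0 < b)%N && ((p == (0%N, b.-1)) || precedes p (0%N, b.-1)))
         (A n)).

(* Membership in t Z/2[t^2]. *)
Definition in_tF2t2 (f : {poly 'F_2}) : Prop :=
  exists q : {poly 'F_2}, f = 'X * (q \Po 'X^2).

(* Main.v *)
Require Import Defs.
From mathcomp Require Import all_boot all_order all_algebra.
From mathcomp Require Import zify ring.

Import GRing.Theory.
Local Open Scope ring_scope.

(** Order pairs by [(c + d, d)] lexicographically.  Condition (1delta) then says
    uniformly that the monomials [c, d] of [A_n] satisfy [(c + 1, d) < (a, b)].
    Multiplying [c, d] by [t^(2 * 2^e)] gives a monomial at most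
    [(c, d) + shift e], with equality when [2 * 2^e] exceeds the exponent of
    [c, d].  Squaring the characteristic polynomial
    [x^(8r) + t^(2r) x^(2r) + t^(8r)] of the recurrence shows that it also holds
    with [r] replaced by any larger power of 2.  Given [n >= 8r], let [8R] be
    the leading binary digit of [n]: since [8R = 2 * 2^(e+2)] and
    [2R = 2 * 2^e] have shifts in ratio 2, both terms of
    [A_n = t^(8R) A_(n-8R) + t^(2R) A_(n-6R)] satisfy the bound required
    of [A_n]. *)

(** Since [g] reads binary digits in base 4, [code] interleaves the digits of [a] (even places) with
    those of [b] (odd places). *)
Definition code (a b : nat) : nat := (g a + 2 * g b)%N.

Lemma code_half a b :
  code a b = (4 * code a./2 b./2 + odd a + 2 * odd b)%N.
Proof. by rewrite /code (gE a) (gE b); lia. Qed.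

Lemma code_double c d x y : (x <= 1)%N -> (y <= 1)%N ->
  code (2 * c + x) (2 * d + y) = (4 * code c d + x + 2 * y)%N.
Proof.
move=> x1 y1; rewrite code_half.
have -> : (2 * c + x)./2 = c by lia.
have -> : (2 * d + y)./2 = d by lia.
lia.
Qed.

Lemma code_surj m : exists a b, m = code a b.
Proof.
have [|[a b] /(congr1 (fun q : {poly 'F_2} => size q))] :=
  @mono_surj (2 * m + 1)%N; first lia.
by rewrite !size_polyXn /= => h; exists a, b; rewrite /code; lia.
Qed.

Lemma Xn_eq_mono m a b :
  ('X^(2 * m + 1) = mono (a, b) :> {poly 'F_2}) <-> m = code a b.
Proof.
rewrite /mono /code /=; split=> [/(congr1 (fun q : {poly 'F_2} => size q))|->].
  by rewrite !size_polyXn; lia.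
by congr 'X^_; lia.
Qed.

(* [t^(2 * 2^e)] times [a, b] is [(a, b) + shift e] when no carry occurs. *)
Fixpoint shift (e : nat) : nat * nat :=
  match e with
  | 0 => (1, 0)
  | 1 => (0, 1)
  | e'.+2 => (2 * (shift e').1, 2 * (shift e').2)
  end%N.

Lemma nat_ind2 (P : nat -> Prop) :
  P 0%N -> P 1%N -> (forall n, P n -> P n.+2) -> forall n, P n.
Proof.
move=> P0 P1 PSS n; suff [] : P n /\ P n.+1 by [].
by elim: n => [|n [? ?]]; split=> //; apply: PSS.
Qed.

Definition wle (c d a b : nat) : bool :=
  ((c + d < a + b) || ((c + d == a + b) && (d <= b)))%N.

Definition wlt (c d a b : nat) : bool :=
  ((c + d < a + b) || ((c + d == a + b) && (d < b)))%N.

(** Equality holds when [c] is even. A carry either turns a unit of [c] into a unit of [d] or passes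
    on to the halves; both give [c' + d' < c + 1 + d]. *)
Lemma code_add1 c d :
  exists c' d', (code c d + 1 = code c' d')%N /\ wle c' d' (c + 1) d.
Proof.
have [m] := ubnP (c + d)%N; elim: m c d => // m IH c d hm.
case oc : (odd c); last first.
  exists (2 * c./2 + 1)%N, (2 * d./2 + odd d)%N.
  rewrite code_double ?leq_b1 // code_half /wle; lia.
case od : (odd d); last first.
  exists (2 * c./2 + 0)%N, (2 * d./2 + 1)%N.
  rewrite code_double // code_half /wle; lia.
have [|c' [d' [e l]]] := IH c./2 d./2; first lia.
exists (2 * c' + 0)%N, (2 * d' + 0)%N.
rewrite code_double // code_half; move: l; rewrite /wle; lia.
Qed.

Lemma code_add_exp e c d : exists c' d',
  (code c d + 2 ^ e = code c' d')%N /\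
  wle c' d' (c + (shift e).1) (d + (shift e).2).
Proof.
elim/nat_ind2: e c d => [||e IH] c d.
- by have [c' [d' [h l]]] := code_add1 c d; exists c', d'; rewrite /= addn0.
- case od : (odd d); last first.
    exists (2 * c./2 + odd c)%N, (2 * d./2 + 1)%N.
    rewrite code_double ?leq_b1 // code_half /wle /=; lia.
  (* The carry clears the last digit of [d] and adds 1 to the code of the halves. The sum may stay
     equal to [c + d + 1], but then [d' < d]. *)
  have [c' [d' [e l]]] := code_add1 c./2 d./2.
  exists (2 * c' + odd c)%N, (2 * d' + 0)%N.
  rewrite code_double ?leq_b1 // code_half; move: l; rewrite /wle /=; lia.
- have [c' [d' [h l]]] := IH c./2 d./2.
  exists (2 * c' + odd c)%N, (2 * d' + odd d)%N.
  rewrite code_double ?leq_b1 // code_half !expnS /=.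
  by move: (shift e) l => [x y]; rewrite /wle /=; lia.
Qed.

(** All digits lie below place [e], so adding [2 ^ e] only writes a new leading digit, in [a] or [b]
    by the parity of [e]. *)
Lemma code_add_shift e a b : (code a b < 2 ^ e)%N ->
  code (a + (shift e).1) (b + (shift e).2) = (code a b + 2 ^ e)%N.
Proof.
elim/nat_ind2: e a b => [||e IH] a b.
- rewrite expn0 ltnS leqn0 => /eqP ab.
  by have [|-> ->] := @g_add_inj a b 0 0.
- move=> h; have [ab|ab] : (code a b = 0 \/ code a b = 1)%N by lia.
    by have [|-> ->] := @g_add_inj a b 0 0.
  by have [|-> ->] := @g_add_inj a b 1 0.
- rewrite !expnS => h; have := IH a./2 b./2; rewrite code_half in h.
  have -> : (a + (shift e.+2).1 = 2 * (a./2 + (shift e).1) + odd a)%N.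
    by move=> /=; case: (shift e) => x y /=; lia.
  have -> : (b + (shift e.+2).2 = 2 * (b./2 + (shift e).2) + odd b)%N.
    by move=> /=; case: (shift e) => x y /=; lia.
  rewrite code_double ?leq_b1 // (code_half a b); lia.
Qed.

(** Coefficientwise form of [sum_of_monomials], stable under sums without tracking cancellations. *)
Definition supported (P : pred (nat * nat)) (f : {poly 'F_2}) : Prop :=
  forall i, f`_i != 0 -> exists c d, i = (2 * code c d + 1)%N /\ P (c, d).

Lemma mono_code c d : mono (c, d) = 'X^(2 * code c d + 1).
Proof. by apply/esym/Xn_eq_mono. Qed.

Lemma sum_of_monomialsP P f : sum_of_monomials P f <-> supported P f.
Proof.
split=> [[s [_ Ps ->]] i|sf].
  elim: s Ps => [|[c d] s IH] /=; first by rewrite big_nil coef0 eqxx.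
  case/andP=> Pcd Ps; rewrite big_cons coefD mono_code coefXn.
  have [-> _|_] := eqVneq i (2 * code c d + 1)%N; first by exists c, d.
  by rewrite add0r; apply: IH.
pose l := [seq i <- iota 0 (size f) | f`_i != 0].
have Hl : forall i, i \in l -> f`_i != 0 by move=> i; rewrite mem_filter => /andP[].
have [s [Ps es]] : exists s, all P s /\ map mono s = [seq 'X^i | i <- l].
  elim: l Hl => [|i l IH] Hl; first by exists [::].
  have [|s [Ps es]] := IH; first by move=> j jl; apply: Hl; rewrite inE jl orbT.
  have [|c [d [ei Pcd]]] := sf i; first by apply: Hl; rewrite inE eqxx.
  by exists ((c, d) :: s); rewrite /= Pcd Ps es mono_code -ei.
exists s; split=> //.
  rewrite es map_inj_uniq ?filter_uniq ?iota_uniq // => i j.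
  by move/(congr1 (fun q : {poly 'F_2} => size q)); rewrite !size_polyXn => -[].
rewrite -(big_map mono xpredT id) es big_map big_filter -[LHS]coefK poly_def.
rewrite -(big_mkord xpredT (fun i => f`_i *: 'X^i)) /index_iota subn0.
rewrite [RHS]big_mkcond; apply: eq_bigr => i _.
have [->|] := eqVneq f`_i 0; first by rewrite scale0r.
by case: (f`_i) => [[|[|//]] h] //= _; rewrite (_ : Ordinal h = 1) ?scale1r //; apply: val_inj.
Qed.

Lemma supported_sub (P Q : pred (nat * nat)) f :
  (forall c d, P (c, d) -> Q (c, d)) -> supported P f -> supported Q f.
Proof. by move=> PQ sf i /sf [c [d [-> /PQ]]]; exists c, d. Qed.

Lemma supportedD P f h : supported P f -> supported P h -> supported P (f + h).
Proof.
move=> sf sh i; rewrite coefD; have [->|/sf//] := eqVneq f`_i 0.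
by rewrite add0r => /sh.
Qed.

(** The order is invariant under translation of pairs, so [code_add_exp] transports the bound. *)
Lemma supported_mulXn e a b f :
  supported (fun p => wlt (p.1 + 1) p.2 a b) f ->
  supported (fun p => wlt (p.1 + 1) p.2 (a + (shift e).1) (b + (shift e).2))
    ('X^(2 * 2 ^ e) * f).
Proof.
move=> sf i; rewrite coefXnM; case: ltnP; rewrite ?eqxx // => hi.
move/sf=> [c [d [ei lcd]]].
have [c' [d' [h l]]] := code_add_exp e c d.
by exists c', d'; split; [lia|move: lcd l; rewrite /wlt /wle /=; case: (shift e) => x y /=; lia].
Qed.

(** For [a = 0] the bound says [c + d < b], which holds exactly for [(0, b - 1)] and the pairs
    preceding it, and never if [b = 0]. *)
Lemma cond1deltaP A m : cond1delta A (2 * m + 1) <->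
  forall a b, m = code a b ->
    supported (fun p => wlt (p.1 + 1) p.2 a b) (A (2 * m + 1)%N).
Proof.
split=> H a b.
  move/Xn_eq_mono/H=> [H1 H2]; have [a0|a0] := posnP a.
    move/sum_of_monomialsP: (H2 a0); apply: supported_sub => c d.
    by rewrite /precedes /wlt xpair_eqE /=; lia.
  move/sum_of_monomialsP: (H1 a0); apply: supported_sub => c d.
  by rewrite /precedes /wlt /=; lia.
move/Xn_eq_mono/H=> sA; split=> a0; apply/sum_of_monomialsP;
  apply: supported_sub sA => c d; rewrite /precedes /wlt ?xpair_eqE /=; lia.
Qed.

Lemma recurrence_double (A : nat -> {poly 'F_2}) r :
  (forall n, odd n ->
     A (n + 8 * r)%N = 'X^(8 * r) * A n + 'X^(2 * r) * A (n + 2 * r)%N) ->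
  forall n, odd n ->
    A (n + 8 * (2 * r))%N =
      'X^(8 * (2 * r)) * A n + 'X^(2 * (2 * r)) * A (n + 2 * (2 * r))%N.
Proof.
move=> H n on.
have -> : (n + 8 * (2 * r) = n + 8 * r + 8 * r)%N by lia.
rewrite H; last by lia.
have -> : (n + 8 * r + 2 * r = n + 2 * r + 8 * r)%N by lia.
rewrite !H //; last by lia.
have -> : (n + 2 * r + 2 * r = n + 2 * (2 * r))%N by lia.
have -> : (8 * (2 * r) = 8 * r + 8 * r)%N by lia.
have -> : (2 * (2 * r) = 2 * r + 2 * r)%N by lia.
rewrite (exprD _ (8 * r) (8 * r)) (exprD _ (2 * r) (2 * r)).
move: 'X^(8 * r) 'X^(2 * r) (A n) => x y f.
move: (A (n + 2 * r)%N) (A (n + (2 * r + 2 * r))%N) => h h'.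
have F2 : 2%N \in [pchar {poly 'F_2}] by rewrite pchar_poly pchar_Fp.
(* The two cross terms cancel in characteristic 2. *)
transitivity (x * x * f + y * y * h' + (x * y * h + x * y * h)); first by ring.
by rewrite (addrr_pchar2 F2) addr0.
Qed.

Theorem theorem3p5 (r : nat) (hr : exists k : nat, r = (2 ^ k)%N)
    (A : nat -> {poly 'F_2})
    (hA : forall n : nat, odd n -> in_tF2t2 (A n))
    (hrec : forall n : nat, odd n ->
       A (n + 8 * r)%N = 'X^(8 * r) * A n + 'X^(2 * r) * A (n + 2 * r)%N)
    (hinit : forall n : nat, odd n -> (n < 8 * r ^ 2)%N -> cond1delta A n) :
  forall n : nat, odd n -> cond1delta A n.
Proof.
case: hr hrec hinit => k -> hrec hinit.
have hrecR j n : odd n -> A (n + 8 * 2 ^ (j + k))%N =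
    'X^(8 * 2 ^ (j + k)) * A n + 'X^(2 * 2 ^ (j + k)) * A (n + 2 * 2 ^ (j + k))%N.
  elim: j n => [|j IH] n; first exact: hrec.
  by rewrite addSn expnS; apply: recurrence_double.
suff H m : cond1delta A (2 * m + 1).
  by move=> n on; have -> : (n = 2 * n./2 + 1)%N by lia.
elim/ltn_ind: m => m IH.
have [small|big] := ltnP (2 * m + 1) (8 * (2 ^ k) ^ 2); first by apply: hinit; lia.
(* This makes the leading digit of [m] equal to [2 ^ e.+2] with [e >= k], so the recurrence is
   available for [R = 2 ^ e]. *)
have mk : (2 ^ (k + 2) <= m)%N.
  have : (0 < 2 ^ k)%N by rewrite expn_gt0.
  by rewrite expnD; nia.
have m0 : (0 < m)%N by apply: leq_trans mk; rewrite expn_gt0.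
have /andP[lo hi] : (2 ^ trunc_log 2 m <= m < 2 ^ (trunc_log 2 m).+1)%N.
  exact: trunc_log_bounds.
have kE : (k + 2 <= trunc_log 2 m)%N by apply: trunc_log_max.
have [j EE] : exists j, trunc_log 2 m = (j + k).+2.
  by exists (trunc_log 2 m - k - 2)%N; lia.
rewrite {}EE in lo hi; move: (j + k)%N (hrecR j) lo hi => e hrecE lo hi.
have E4 : (2 ^ e.+2 = 4 * 2 ^ e)%N by rewrite !expnS; lia.
have e0 : (0 < 2 ^ e)%N by rewrite expn_gt0.
have [m' em] : exists m', m = (m' + 2 ^ e.+2)%N by exists (m - 2 ^ e.+2)%N; lia.
have hm' : (m' < 2 ^ e.+2)%N by move: hi; rewrite em (expnS 2 e.+2); lia.
have [a' [b' em']] := code_surj m'.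
apply/cond1deltaP => a b eab.
have [] : a = (a' + (shift e.+2).1)%N /\ b = (b' + (shift e.+2).2)%N.
  by apply: g_add_inj; rewrite -!/(code _ _) -eab code_add_shift -?em'.
move=> -> ->.
have -> : (2 * m + 1 = 2 * m' + 1 + 8 * 2 ^ e)%N by lia.
rewrite hrecE; last by lia.
apply: supportedD.
  have -> : (8 * 2 ^ e = 2 * 2 ^ e.+2)%N by lia.
  apply: supported_mulXn.
  by have /IH/cond1deltaP : (m' < m)%N by [lia]; apply.
have -> : (2 * m' + 1 + 2 * 2 ^ e = 2 * (m' + 2 ^ e) + 1)%N by lia.
(* The index and the factor [t^(2R)] each contribute at most [shift e], and twice [shift e] is
   [shift e.+2]. *)
have [a2 [b2 [e2 l2]]] := code_add_exp e a' b'.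
have /IH/cond1deltaP/(_ a2 b2) : (m' + 2 ^ e < m)%N by lia.
rewrite {1}em' => /(_ e2)/(supported_mulXn e).
by apply: supported_sub => c d; move: l2; rewrite /wlt /wle /=; case: (shift e) => x y /=; lia.
Qed.
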